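(* For any formula $A$ of the language of $\mathsf{ILL}_\bot$, one obtains the linear Gödel-Gentzen translation $A^{\rm lG}$ from the outer Kolmogorov translation $A^{{\rm K}_o}$ by systematically applying the following formula reductions, starting from the whole formula and inductively applying them to the subformulas: $$\neg\neg(\neg\neg A\,\&\,\neg\neg B)\mapsto\neg\neg A\,\&\,\neg\neg B,\qquad \neg\neg(\neg\neg A\multimap\neg\neg B)\mapsto\neg\neg A\multimap\neg\neg B,\qquad \neg\neg\forall x\,\neg\neg A\mapsto\forall x\,\neg\neg A.$$ Hence $(\cdot)^{\rm lG}$ is a simplification from outside of $(\cdot)^{{\rm K}_o}$ (as translations from $\mathsf{CLL}_{\rm b}$ to $\mathsf{ILL}_\bot$). Moreover, the reductions above are reversible in $\mathsf{ILL}_\bot$ (i.e. the two sides of each reduction are provably equivalent in $\mathsf{ILL}_\bot$).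
   Context: Intuitionistic linear logic $\mathsf{ILL}$ (first order). Formulas are built from atomic formulas, including the constants $1,\top,0$, using $\otimes,\&,\oplus,\multimap$, $\forall x,\exists x$ and $!$. Sequents are $\Gamma\vdash A$ with $\Gamma$ a finite multiset of formulas and exactly one formula on the right. Axioms: $A\vdash A$; $\vdash 1$; $\Gamma\vdash\top$; $\Gamma,0\vdash C$. Rules (premises $\Rightarrow$ conclusion): (cut) $\Gamma\vdash A;\ \Delta,A\vdash C\Rightarrow\Gamma,\Delta\vdash C$; $\Gamma\vdash C\Rightarrow\Gamma,1\vdash C$; $\Gamma\vdash A;\ \Delta\vdash B\Rightarrow\Gamma,\Delta\vdash A\otimes B$; $\Gamma,A,B\vdash C\Rightarrow\Gamma,A\otimes B\vdash C$; $\Gamma,A\vdash B\Rightarrow\Gamma\vdash A\multimap B$; $\Gamma\vdash A;\ \Delta,B\vdash C\Rightarrow\Gamma,\Delta,A\multimap B\vdash C$; $\Gamma\vdash A;\ \Gamma\vdash B\Rightarrow\Gamma\vdash A\& B$; $\Gamma,A\vdash C\Rightarrow\Gamma,A\& B\vdash C$; $\Gamma,B\vdash C\Rightarrow\Gamma,A\& B\vdash C$; $\Gamma\vdash A\Rightarrow\Gamma\vdash A\oplus B$; $\Gamma\vdash B\Rightarrow\Gamma\vdash A\oplus B$; $\Gamma,A\vdash C;\ \Gamma,B\vdash C\Rightarrow\Gamma,A\oplus B\vdash C$; $\Gamma\vdash A\Rightarrow\Gamma\vdash\forall xA$; $\Gamma,A[t/x]\vdash C\Rightarrow\Gamma,\forall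 xA\vdash C$; $\Gamma\vdash A[t/x]\Rightarrow\Gamma\vdash\exists xA$; $\Gamma,A\vdash C\Rightarrow\Gamma,\exists xA\vdash C$ (usual eigenvariable conditions); $\Gamma,!A,!A\vdash C\Rightarrow\Gamma,!A\vdash C$; $\Gamma\vdash C\Rightarrow\Gamma,!A\vdash C$; $!\Gamma\vdash A\Rightarrow\,!\Gamma\vdash\,!A$; $\Gamma,A\vdash C\Rightarrow\Gamma,!A\vdash C$. $\mathsf{ILL}_\bot$ extends $\mathsf{ILL}$ by one more constant $\bot$ (also counted as atomic); its sequents have at most one formula on the right (so $C$ in the rules above may be absent), and it has the additional axiom $\bot\vdash$ and rule $\Gamma\vdash\ \Rightarrow\Gamma\vdash\bot$. $\neg A:=A\multimap\bot$. $\mathsf{DNE}$: $\neg\neg A\vdash A$ (axiom schema). $\mathsf{CLL}_{\rm b}:=\mathsf{ILL}_\bot+\mathsf{DNE}$. Formulas $A,B$ are equivalent over $S$ if $S$ proves $(A\multimap B)\&(B\multimap A)$. Translations. Throughout $\square\in\{\otimes,\&,\oplus,\multimap\}$, $Q\in\{\forall x,\exists x,!\}$. Outer Kolmogorov: $P^{{\rm K}_o}:=\neg\neg P$ ($P$ atomic), $(A\,\square\,B)^{{\rm K}_o}:=\neg\neg(A^{{\rm K}_o}\,\square\,B^{{\rm K}_o})$, $(QA)^{{\rm K}_o}:=\neg\neg QA^{{\rm K}_o}$. Linear Gödel-Gentzen: $P^{\rm lG}:=\neg\neg P$ ($P$ atomic); $(A\otimes B)^{\rm lG}:=\neg\neg(A^{\rm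 lG}\otimes B^{\rm lG})$; $(A\& B)^{\rm lG}:=A^{\rm lG}\& B^{\rm lG}$; $(A\oplus B)^{\rm lG}:=\neg\neg(A^{\rm lG}\oplus B^{\rm lG})$; $(A\multimap B)^{\rm lG}:=A^{\rm lG}\multimap B^{\rm lG}$; $(\forall xA)^{\rm lG}:=\forall xA^{\rm lG}$; $(\exists xA)^{\rm lG}:=\neg\neg\exists xA^{\rm lG}$; $(!A)^{\rm lG}:=\neg\neg\,!A^{\rm lG}$. General notions, for a formula construct $T$ (here $T(A)=\neg\neg A$). A $T$-based outer-transform is $\mathcal T_\square(A,B)=T'(A\,\square\,B)$, resp. $\mathcal T_Q(A)=T'(QA)$, with $T'\in\{T,\mathrm{Id}\}$. A modular outer $T$-translation is one given by outer-transforms via $P^{\rm Tr}:=T(P)$ ($P$ atomic), $(A\,\square\,B)^{\rm Tr}:=\mathcal T^{\rm Tr}_\square(A^{\rm Tr},B^{\rm Tr})$, $(QA)^{\rm Tr}:=\mathcal T^{\rm Tr}_Q(A^{\rm Tr})$. A transform is simpler than another one for the same connective, quantifier or modality if the latter uses $T$ in all places where the former does, but not conversely. A translation is sound from $S_1$ to $S_2$ if for all $A$: $\vdash_{S_1}A$ implies $\vdash_{S_2}A^{\rm Tr}$, and $A$, $A^{\rm Tr}$ are equivalent over $S_1$. Two sound translations from $S_1$ to $S_2$ are equivalent if $A^{\rm Tr}$ and $A^{{\rm Tr}'}$ are equivalent over $S_2$ for all $A$. For equivalent translations, ${\rm Tr}'$ is a simplification of ${\rm Tr}$ if each transform of ${\rm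 Tr}'$ is identical to or simpler than the corresponding one of ${\rm Tr}$, and simpler in at least one case. For two equivalent modular outer $T$-translations, ${\rm Tr}'$ is a simplification from outside of ${\rm Tr}$ if it is a simplification of ${\rm Tr}$ and $A^{{\rm Tr}'}$ is obtained from $A^{\rm Tr}$ by applying the reductions $\mathcal T^{\rm Tr}_\square(T(A),T(B))\mapsto\mathcal T^{{\rm Tr}'}_\square(T(A),T(B))$ and $\mathcal T^{\rm Tr}_Q(T(A))\mapsto\mathcal T^{{\rm Tr}'}_Q(T(A))$ recursively, starting from the whole formula and working towards the atomic formulas (at each stage the reduction matching the current formula, if there is one, is applied to it, and one then continues with the parts $T(A)$, $T(B)$ that are the translations of the immediate subformulas). *)

(* Defs.v *)
(* Finite multisets of formulas are sequences taken up to Permutation. *)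
From Stdlib Require Import Permutation.
From mathcomp Require Import all_boot.

Set Implicit Arguments.
Unset Strict Implicit.
Unset Printing Implicit Defensive.

Record signature := Signature {
  fsym : Type;
  farity : fsym -> nat;
  psym : Type;
  parity : psym -> nat
}.

(* Variables are de Bruijn indices, so alpha-equivalent formulas are equal. *)
Inductive term (S : signature) : Type :=
| Var of nat
| App (f : fsym S) of {ffun 'I_(farity f) -> term S}.

Inductive atom (S : signature) : Type :=
| Pred (p : psym S) of {ffun 'I_(parity p) -> term S}
| One | Top | Zero | Bot.

Variant binop := Tensor | With | Plus | Limp.
Variant unop := All | Ex | Bang.

(* [Un All A] and [Un Ex A] bind index 0 in [A]; [Un Bang A] binds nothing. *)
Inductive form (S : signature) : Type :=
| At of atom S
| Bin of binop & form S & form S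
| Un of unop & form S.

Arguments Var {S}.
Arguments One {S}.
Arguments Top {S}.
Arguments Zero {S}.
Arguments Bot {S}.

Section Logic.
Variable S : signature.
Local Notation term := (term S).
Local Notation atom := (atom S).
Local Notation form := (form S).

Fixpoint tsubst (s : nat -> term) (t : term) : term :=
  match t with
  | Var n => s n
  | App f ts => App [ffun i => tsubst s (ts i)]
  end.

Definition asubst (s : nat -> term) (a : atom) : atom :=
  match a with
  | Pred p ts => Pred [ffun i => tsubst s (ts i)]
  | One => One
  | Top => Top
  | Zero => Zero
  | Bot => Bot
  end.

Definition scons (t : term) (s : nat -> term) (n : nat) : term :=
  if n is m.+1 then s m else t.

Definition shift_var (n : nat) : term := Var n.+1.

Definition up (s : nat -> term) : nat -> term :=
  scons (Var 0) (fun n => tsubst shift_var (s n)).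

Fixpoint fsubst (s : nat -> term) (A : form) : form :=
  match A with
  | At a => At (asubst s a)
  | Bin b A B => Bin b (fsubst s A) (fsubst s B)
  | Un Bang A => Un Bang (fsubst s A)
  | Un q A => Un q (fsubst (up s) A)
  end.

Definition shift : form -> form := fsubst shift_var.

(* A[t/x], where x is the variable bound by the removed quantifier. *)
Definition inst (A : form) (t : term) : form := fsubst (scons t Var) A.

Definition neg (A : form) : form := Bin Limp A (At Bot).
Definition nn (A : form) : form := neg (neg A).

(* Provability of a sequent with at most one formula on the right. *)
Definition system := seq form -> option form -> Prop.

(* [derives Ax] is intuitionistic linear logic with bottom, extended by the
   sequents in [Ax] as axioms. In [d_allR] and [d_exL] the eigenvariable is
   index 0 of the premise; shifting the side formulas makes it fresh. *)
Inductive derives (Ax : system) : system :=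
| d_ax G C : Ax G C -> derives Ax G C
| d_perm G D C : Permutation G D -> derives Ax G C -> derives Ax D C
| d_id A : derives Ax [:: A] (Some A)
| d_cut G D A C :
    derives Ax G (Some A) -> derives Ax (A :: D) C -> derives Ax (G ++ D) C
| d_oneR : derives Ax [::] (Some (At One))
| d_oneL G C : derives Ax G C -> derives Ax (At One :: G) C
| d_topR G : derives Ax G (Some (At Top))
| d_zeroL G C : derives Ax (At Zero :: G) C
| d_botL : derives Ax [:: At Bot] None
| d_botR G : derives Ax G None -> derives Ax G (Some (At Bot))
| d_tensorR G D A B :
    derives Ax G (Some A) -> derives Ax D (Some B) ->
    derives Ax (G ++ D) (Some (Bin Tensor A B))
| d_tensorL G A B C :
    derives Ax [:: A, B & G] C -> derives Ax (Bin Tensor A B :: G) C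
| d_limpR G A B :
    derives Ax (A :: G) (Some B) -> derives Ax G (Some (Bin Limp A B))
| d_limpL G D A B C :
    derives Ax G (Some A) -> derives Ax (B :: D) C ->
    derives Ax (Bin Limp A B :: G ++ D) C
| d_withR G A B :
    derives Ax G (Some A) -> derives Ax G (Some B) ->
    derives Ax G (Some (Bin With A B))
| d_withL1 G A B C :
    derives Ax (A :: G) C -> derives Ax (Bin With A B :: G) C
| d_withL2 G A B C :
    derives Ax (B :: G) C -> derives Ax (Bin With A B :: G) C
| d_plusR1 G A B :
    derives Ax G (Some A) -> derives Ax G (Some (Bin Plus A B))
| d_plusR2 G A B :
    derives Ax G (Some B) -> derives Ax G (Some (Bin Plus A B))
| d_plusL G A B C :
    derives Ax (A :: G) C -> derives Ax (B :: G) C ->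
    derives Ax (Bin Plus A B :: G) C
| d_allR G A :
    derives Ax [seq shift B | B <- G] (Some A) ->
    derives Ax G (Some (Un All A))
| d_allL G A t C :
    derives Ax (inst A t :: G) C -> derives Ax (Un All A :: G) C
| d_exR G A t :
    derives Ax G (Some (inst A t)) -> derives Ax G (Some (Un Ex A))
| d_exL G A C :
    derives Ax (A :: [seq shift B | B <- G]) (omap shift C) ->
    derives Ax (Un Ex A :: G) C
| d_contr G A C :
    derives Ax [:: Un Bang A, Un Bang A & G] C -> derives Ax (Un Bang A :: G) C
| d_weak G A C : derives Ax G C -> derives Ax (Un Bang A :: G) C
| d_prom G A :
    derives Ax [seq Un Bang B | B <- G] (Some A) ->
    derives Ax [seq Un Bang B | B <- G] (Some (Un Bang A))
| d_derel G A C : derives Ax (A :: G) C -> derives Ax (Un Bang A :: G) C.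

Variant dne : system := Dne A : dne [:: nn A] (Some A).

Definition ILLbot : system := derives (fun _ _ => False).
Definition CLLb : system := derives dne.

Definition proves (L : system) (A : form) : Prop := L [::] (Some A).

Definition equivalent (L : system) (A B : form) : Prop :=
  proves L (Bin With (Bin Limp A B) (Bin Limp B A)).

Fixpoint Ko (A : form) : form :=
  match A with
  | At a => nn (At a)
  | Bin b A B => nn (Bin b (Ko A) (Ko B))
  | Un q A => nn (Un q (Ko A))
  end.

Fixpoint lG (A : form) : form :=
  match A with
  | At a => nn (At a)
  | Bin Tensor A B => nn (Bin Tensor (lG A) (lG B))
  | Bin With A B => Bin With (lG A) (lG B)
  | Bin Plus A B => nn (Bin Plus (lG A) (lG B))
  | Bin Limp A B => Bin Limp (lG A) (lG B)
  | Un All A => Un All (lG A)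
  | Un Ex A => nn (Un Ex (lG A))
  | Un Bang A => nn (Un Bang (lG A))
  end.

(* An outer-transform is determined by whether T' is T ([true]) or the
   identity ([false]). *)
Record outer_transforms := OuterTransforms {
  tr_bin : binop -> bool;
  tr_un : unop -> bool
}.

Definition outer (T : form -> form) (u : bool) (A : form) : form :=
  if u then T A else A.

Fixpoint modular (T : form -> form) (t : outer_transforms) (A : form) : form :=
  match A with
  | At a => T (At a)
  | Bin b A B => outer T (tr_bin t b) (Bin b (modular T t A) (modular T t B))
  | Un q A => outer T (tr_un t q) (Un q (modular T t A))
  end.

Definition simpler (u' u : bool) : bool := (u' ==> u) && ~~ (u ==> u').

Definition sound (L1 L2 : system) (tr : form -> form) : Prop :=
  forall A, (proves L1 A -> proves L2 (tr A)) /\ equivalent L1 A (tr A).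

Definition equivalent_translations (L1 L2 : system) (tr tr' : form -> form) :
    Prop :=
  [/\ sound L1 L2 tr, sound L1 L2 tr' & forall A, equivalent L2 (tr A) (tr' A)].

(* The translation given by [t'] is a simplification of that given by [t]. *)
Definition simplification (L1 L2 : system) (T : form -> form)
    (t' t : outer_transforms) : Prop :=
  [/\ equivalent_translations L1 L2 (modular T t) (modular T t'),
      forall b, tr_bin t' b = tr_bin t b \/ simpler (tr_bin t' b) (tr_bin t b),
      forall q, tr_un t' q = tr_un t q \/ simpler (tr_un t' q) (tr_un t q)
    & (exists b, simpler (tr_bin t' b) (tr_bin t b)) \/
      (exists q, simpler (tr_un t' q) (tr_un t q))].

(* One stage at the current formula: the matching reduction of [R] must be
   applied if there is one; otherwise the formula is kept. *)
Definition stage (R : form -> form -> Prop) (F F1 : form) : Prop :=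
  R F F1 \/ (~ (exists F', R F F') /\ F1 = F).

(* [outside_in T R F G]: G results from F by a stage at the root, followed by
   the same procedure on the parts T(A), T(B) of the outcome of that stage. *)
Inductive outside_in (T : form -> form) (R : form -> form -> Prop) :
    form -> form -> Prop :=
| oi_atom F a : stage R F (T (At a)) -> outside_in T R F (T (At a))
| oi_bin F u b A B GA GB :
    stage R F (outer T u (Bin b (T A) (T B))) ->
    outside_in T R (T A) GA -> outside_in T R (T B) GB ->
    outside_in T R F (outer T u (Bin b GA GB))
| oi_un F u q A GA :
    stage R F (outer T u (Un q (T A))) ->
    outside_in T R (T A) GA ->
    outside_in T R F (outer T u (Un q GA)).

Variant transform_red (T : form -> form) (t t' : outer_transforms) :
    form -> form -> Prop :=
| tred_bin b A B :
    transform_red T t t' (outer T (tr_bin t b) (Bin b (T A) (T B)))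
                         (outer T (tr_bin t' b) (Bin b (T A) (T B)))
| tred_un q A :
    transform_red T t t' (outer T (tr_un t q) (Un q (T A)))
                         (outer T (tr_un t' q) (Un q (T A))).

(* [tr'] is a simplification from outside of [tr]. *)
Definition simplification_from_outside (L1 L2 : system) (T : form -> form)
    (tr' tr : form -> form) : Prop :=
  exists t' t : outer_transforms,
    [/\ tr' =1 modular T t', tr =1 modular T t, simplification L1 L2 T t' t
      & forall A, outside_in T (transform_red T t t') (tr A) (tr' A)].

Variant lG_red : form -> form -> Prop :=
| red_with A B :
    lG_red (nn (Bin With (nn A) (nn B))) (Bin With (nn A) (nn B))
| red_limp A B :
    lG_red (nn (Bin Limp (nn A) (nn B))) (Bin Limp (nn A) (nn B))
| red_all A : lG_red (nn (Un All (nn A))) (Un All (nn A)).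

End Logic.

(* Main.v *)
(** Both translations send every formula to one that is stable under double
    negation. Hence a doubly negated formula may replace the formula itself on
    the left of any sequent with a translated (or absent) right-hand side; this
    turns each rule of CLL_b into a derivable rule of ILL_bot for K_o.
    The clauses in which lG drops the outer double negation are those whose
    connective or quantifier preserves stability, which gives both the
    reversibility of the reductions and, by induction, the equivalence of lG
    with K_o; soundness of lG is then inherited from K_o. *)
From Stdlib Require Import Permutation.
From mathcomp Require Import all_boot.
Require Import Defs.

Set Implicit Arguments.
Unset Strict Implicit.
Unset Printing Implicit Defensive.

(** * Substitution and its commutation with [Ko] *)

Definition term_nested_ind (S : signature) (P : term S -> Prop)
    (PVar : forall n, P (Var n))
    (PApp : forall f (ts : {ffun 'I_(farity f) -> term S}),
      (forall i, P (ts i)) -> P (App ts)) : forall t, P t :=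
  fix F t : P t :=
    match t with
    | Var n => PVar n
    | App f ts => PApp f ts (fun i => F (ts i))
    end.

Lemma tsubst_comp (S : signature) (r s q : nat -> term S) :
  (forall n, tsubst s (r n) = q n) ->
  forall t, tsubst s (tsubst r t) = tsubst q t.
Proof.
move=> E; elim/term_nested_ind => [n|f ts IH] /=; first exact: E.
by congr App; apply/ffunP=> i; rewrite !ffunE.
Qed.

Lemma tsubst_id (S : signature) (t : term S) : tsubst Var t = t.
Proof.
elim/term_nested_ind: t => [n|f ts IH] //=.
by congr App; apply/ffunP=> i; rewrite !ffunE.
Qed.

(** Shifting and then applying [up s] agrees with applying [s] and then shifting, so the
    cancellation hypothesis is still usable under a binder. *)
Lemma up_cancel (S : signature) (r s : nat -> term S) :
  (forall n, tsubst s (r n) = Var n) ->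
  forall n, tsubst (up s) (up r n) = Var n.
Proof.
move=> E [|n] //=.
rewrite (tsubst_comp (q := fun m => tsubst (@shift_var S) (s m))) //.
by rewrite -(@tsubst_comp S s (@shift_var S)) // E.
Qed.

Lemma fsubst_cancel (S : signature) (A : form S) (r s : nat -> term S) :
  (forall n, tsubst s (r n) = Var n) -> fsubst s (fsubst r A) = A.
Proof.
elim: A r s => [a|b A IHA B IHB|[] A IHA] r s E /=.
- case: a => //= p ts; do 2 congr (_ _).
  by apply/ffunP=> i; rewrite !ffunE (tsubst_comp E) tsubst_id.
- by rewrite IHA // IHB.
- by rewrite IHA //; exact: up_cancel.
- by rewrite IHA //; exact: up_cancel.
- by rewrite IHA.
Qed.

(** [d_allR] and [d_exL] shift quantified side formulas; instantiating such a formula with the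
    eigenvariable [Var 0] recovers its original body. *)
Lemma inst_up_shift (S : signature) (A : form S) :
  inst (fsubst (up (@shift_var S)) A) (Var 0) = A.
Proof. by apply: fsubst_cancel => -[|n]. Qed.

Lemma Ko_fsubst (S : signature) (A : form S) s :
  Ko (fsubst s A) = fsubst s (Ko A).
Proof.
elim: A s => [a|b A IHA B IHB|[] A IHA] s //=; by rewrite ?IHA ?IHB.
Qed.

Lemma map_Ko_shift (S : signature) (G : seq (form S)) :
  [seq Ko B | B <- [seq shift B | B <- G]] =
  [seq shift B | B <- [seq Ko B | B <- G]].
Proof. by elim: G => //= A G ->; rewrite Ko_fsubst. Qed.

(** * Derived rules for negation and double negation *)

Definition entails (S : signature) (L : system S) (A B : form S) : Prop :=
  L [:: A] (Some B).

Definition interderivable (S : signature) (L : system S) (A B : form S) : Prop :=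
  entails L A B /\ entails L B A.

Definition stable (S : signature) (L : system S) (A : form S) : Prop :=
  entails L (nn A) A.

Lemma d_swap (S : signature) (Ax : system S) A B G C :
  derives Ax [:: A, B & G] C -> derives Ax [:: B, A & G] C.
Proof. apply: d_perm; exact: perm_swap. Qed.

Lemma d_catC (S : signature) (Ax : system S) G D C :
  derives Ax (G ++ D) C -> derives Ax (D ++ G) C.
Proof. apply: d_perm; exact: Permutation_app_comm. Qed.

Lemma d_cutL (S : signature) (Ax : system S) A B G C :
  entails (derives Ax) A B -> derives Ax (B :: G) C -> derives Ax (A :: G) C.
Proof. by move=> AB; apply: (d_cut AB). Qed.

Lemma d_cutR (S : signature) (Ax : system S) G A B :
  derives Ax G (Some A) -> entails (derives Ax) A B -> derives Ax G (Some B).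
Proof. by move=> GA AB; rewrite -(cats0 G); apply: d_cut GA AB. Qed.

Lemma d_negL (S : signature) (Ax : system S) G A :
  derives Ax G (Some A) -> derives Ax (neg A :: G) None.
Proof.
by move=> GA; rewrite -(cats0 G); apply: d_limpL GA _; apply: d_botL.
Qed.

Lemma d_negR (S : signature) (Ax : system S) G A :
  derives Ax (A :: G) None -> derives Ax G (Some (neg A)).
Proof. by move=> H; apply/d_limpR/d_botR. Qed.

Lemma d_limp_inv (S : signature) (Ax : system S) G A B :
  derives Ax G (Some (Bin Limp A B)) -> derives Ax (A :: G) (Some B).
Proof.
move=> H; apply: (@d_catC _ _ G [:: A]); apply: (d_cut H).
exact: (d_limpL (D := [::]) (d_id _ A) (d_id _ B)).
Qed.

Lemma d_neg_inv (S : signature) (Ax : system S) G A :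
  derives Ax G (Some (neg A)) -> derives Ax (A :: G) None.
Proof.
move=> /d_limp_inv H; rewrite -(cats0 (A :: G)).
apply: (d_cut H); exact: d_botL.
Qed.

Lemma d_nnL_None (S : signature) (Ax : system S) G A :
  derives Ax (A :: G) None -> derives Ax (nn A :: G) None.
Proof. by move=> H; apply/d_negL/d_negR. Qed.

(** A negated goal can be moved to the left, which empties the right-hand side; there [A] and [nn A]
    are interchangeable. *)
Lemma d_nnL_neg (S : signature) (Ax : system S) G A C :
  derives Ax (A :: G) (Some (neg C)) -> derives Ax (nn A :: G) (Some (neg C)).
Proof. by move=> /d_neg_inv/d_swap/d_nnL_None/d_swap/d_negR. Qed.

Lemma d_nnR (S : signature) (Ax : system S) G A :
  derives Ax G (Some A) -> derives Ax G (Some (nn A)).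
Proof. by move=> H; apply/d_negR/d_negL. Qed.

Lemma entails_nnI (S : signature) (Ax : system S) A :
  entails (derives Ax) A (nn A).
Proof. exact/d_nnR/d_id. Qed.

Lemma entails_nn (S : signature) (Ax : system S) A B :
  entails (derives Ax) A B -> entails (derives Ax) (nn A) (nn B).
Proof. by move=> AB; apply/d_nnL_neg/d_nnR. Qed.

(** * Formulas stable under double negation *)

Lemma stable_neg (S : signature) (Ax : system S) A :
  stable (derives Ax) (neg A).
Proof. exact/d_nnL_neg/d_id. Qed.

Lemma stable_with (S : signature) (Ax : system S) A B :
  stable (derives Ax) A -> stable (derives Ax) B ->
  stable (derives Ax) (Bin With A B).
Proof.
move=> sA sB; apply: d_withR.
- by apply: d_cutR sA; apply/entails_nn/d_withL1/d_id.
- by apply: d_cutR sB; apply/entails_nn/d_withL2/d_id.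
Qed.

Lemma stable_limp (S : signature) (Ax : system S) A B :
  stable (derives Ax) B -> stable (derives Ax) (Bin Limp A B).
Proof.
move=> sB; apply/d_limpR; apply: d_cutR sB.
(* The goal is now [nn B], a negation, so the outer double negation on the implication can be
   stripped and the antecedent [A] fed to it. *)
apply/d_swap/d_nnL_neg/d_swap/d_nnR.
exact/d_limp_inv/d_id.
Qed.

Lemma stable_all (S : signature) (Ax : system S) A :
  stable (derives Ax) A -> stable (derives Ax) (Un All A).
Proof.
move=> sA; apply: d_allR => /=; apply: d_cutR sA; apply: entails_nn.
by apply: (d_allL (t := Var 0)); rewrite inst_up_shift; apply: d_id.
Qed.

(** * Interderivability as a congruence *)

Lemma interderivable_trans (S : signature) (Ax : system S) A B C :
  interderivable (derives Ax) A B -> interderivable (derives Ax) B C ->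
  interderivable (derives Ax) A C.
Proof.
by move=> [AB BA] [BC CB]; split; [apply: d_cutR BC | apply: d_cutR BA].
Qed.

Lemma interderivable_equivalent (S : signature) (Ax : system S) A B :
  interderivable (derives Ax) A B -> equivalent (derives Ax) A B.
Proof. by case=> AB BA; apply: d_withR; apply: d_limpR. Qed.

Lemma interderivable_nn (S : signature) (Ax : system S) A B :
  interderivable (derives Ax) A B -> interderivable (derives Ax) (nn A) (nn B).
Proof. by case=> AB BA; split; apply: entails_nn. Qed.

Lemma interderivable_stable (S : signature) (Ax : system S) A :
  stable (derives Ax) A -> interderivable (derives Ax) (nn A) A.
Proof. by split=> //; apply: entails_nnI. Qed.

(** Interderivability is assumed because [Limp] is contravariant in its first argument. *)
Lemma entails_bin (S : signature) (Ax : system S) b A A' B B' :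
  interderivable (derives Ax) A A' -> interderivable (derives Ax) B B' ->
  entails (derives Ax) (Bin b A B) (Bin b A' B').
Proof.
move=> [AA' A'A] [BB' B'B]; case: b.
- exact: d_tensorL (d_tensorR AA' BB').
- by apply: d_withR; [apply: d_withL1 | apply: d_withL2].
- by apply: d_plusL; [apply: d_plusR1 | apply: d_plusR2].
- by apply/d_limpR/d_swap; apply: (d_limpL (D := [::]) A'A BB').
Qed.

Lemma entails_un (S : signature) (Ax : system S) q A B :
  entails (derives Ax) A B -> entails (derives Ax) (Un q A) (Un q B).
Proof.
move=> AB; case: q.
- apply: d_allR => /=; apply: (d_allL (t := Var 0)).
  by rewrite inst_up_shift.
- apply: d_exL => /=; apply: (d_exR (t := Var 0)).
  by rewrite inst_up_shift.
- by apply: (d_prom (G := [:: A])); apply: d_derel.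
Qed.

Lemma interderivable_bin (S : signature) (Ax : system S) b A A' B B' :
  interderivable (derives Ax) A A' -> interderivable (derives Ax) B B' ->
  interderivable (derives Ax) (Bin b A B) (Bin b A' B').
Proof.
by move=> IA IB; split; apply: entails_bin => //; apply/and_comm.
Qed.

Lemma interderivable_un (S : signature) (Ax : system S) q A B :
  interderivable (derives Ax) A B ->
  interderivable (derives Ax) (Un q A) (Un q B).
Proof. by case=> AB BA; split; apply: entails_un. Qed.

(** * Comparison of the two translations with each other and with the identity *)

Lemma stable_lG (S : signature) (Ax : system S) A :
  stable (derives Ax) (lG A).
Proof.
elim: A => [a|[] A IHA B IHB|[] A IHA] /=; try exact: stable_neg.
- exact: stable_with.
- exact: stable_limp.
- exact: stable_all.
Qed.

(** Congruence replaces the components inside the outer double negation, which [lG] then either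
    keeps or drops by stability. [Ax] is arbitrary because soundness of [lG] uses this over both
    [ILLbot] and [CLLb]. *)
Lemma Ko_lG (S : signature) (Ax : system S) A :
  interderivable (derives Ax) (Ko A) (lG A).
Proof.
elim: A => [a|b A IHA B IHB|q A IHA].
- by split; apply: d_id.
- apply: (interderivable_trans (interderivable_nn (interderivable_bin b IHA IHB))).
  case: b; try by split; apply: d_id.
  + exact/interderivable_stable/(stable_lG _ (Bin With A B)).
  + exact/interderivable_stable/(stable_lG _ (Bin Limp A B)).
- apply: (interderivable_trans (interderivable_nn (interderivable_un q IHA))).
  case: q; try by split; apply: d_id.
  exact/interderivable_stable/(stable_lG _ (Un All A)).
Qed.

Lemma stable_CLLb (S : signature) (A : form S) : stable (@CLLb S) A.
Proof. exact/d_ax/Dne. Qed.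

Lemma CLLb_Ko (S : signature) (A : form S) : interderivable (@CLLb S) (Ko A) A.
Proof.
elim: A => [a|b A IHA B IHB|q A IHA] /=.
- exact/interderivable_stable/stable_CLLb.
- apply: (interderivable_trans (interderivable_nn (interderivable_bin b IHA IHB))).
  exact/interderivable_stable/stable_CLLb.
- apply: (interderivable_trans (interderivable_nn (interderivable_un q IHA))).
  exact/interderivable_stable/stable_CLLb.
Qed.

(** * Soundness of the translations *)

Lemma Ko_nn (S : signature) (A : form S) : exists B, Ko A = nn B.
Proof. by case: A => *; eexists. Qed.

Lemma d_nnL_Ko (S : signature) (Ax : system S) G A C :
  derives Ax (A :: G) (omap (@Ko S) C) ->
  derives Ax (nn A :: G) (omap (@Ko S) C).
Proof.
case: C => [C|] /=; last exact: d_nnL_None.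
by have [B ->] := Ko_nn C; apply: d_nnL_neg.
Qed.

Lemma d_replace_all (S : signature) (Ax : system S) (f g : form S -> form S) C :
  (forall A D, derives Ax (f A :: D) C -> derives Ax (g A :: D) C) ->
  forall G, derives Ax [seq f A | A <- G] C -> derives Ax [seq g A | A <- G] C.
Proof.
move=> fg G; rewrite -(cats0 (map f G)) -(cats0 (map g G)).
(* The empty tail is generalized to [D], which accumulates the formulas already replaced. *)
elim: G [::] => //= A G IHG D /fg H.
suff /d_catC : derives Ax ([seq g A | A <- G] ++ (g A :: D)) C.
  by move=> /= H'; apply: d_perm H'; apply: perm_skip; exact: Permutation_app_comm.
apply: IHG; apply: d_perm H; exact: Permutation_middle.
Qed.

(** With [Ko A] of the form [nn B], the formula [neg B] proves [Ko (neg A)]; the translated falsum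
    [nn (At Bot)] that then results is still contradictory. *)
Lemma Ko_dne (S : signature) (Ax : system S) (A : form S) :
  entails (derives Ax) (Ko (nn A)) (Ko A).
Proof.
have [B /= E] := Ko_nn A; rewrite E; apply/d_nnL_neg.
have nnB : derives Ax [:: nn (At Bot)] None by apply/d_nnL_None/d_botL.
apply/d_negR/d_swap; apply: (d_limpL (G := [:: neg B]) _ nnB).
apply/d_nnR/d_limpR/d_nnR/d_botR/d_negL/d_id.
Qed.

(** Induction on the derivation: a right rule is applied and then [d_nnR], a left rule and then
    [d_nnL_Ko]. Only contraction and promotion need more, since their premises contain [!] formulas
    that the translation also double-negates. *)
Lemma Ko_derives (S : signature) (G : seq (form S)) C :
  CLLb G C -> ILLbot [seq Ko A | A <- G] (omap (@Ko S) C).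
Proof.
rewrite /ILLbot; elim=> {G C} /=.
- by move=> _ _ [A]; apply: Ko_dne.
- by move=> G D C GD _; apply: d_perm; exact: Permutation_map.
- by move=> A; apply: d_id.
- by move=> G D A C _ IHA _ IHC; rewrite map_cat; apply: d_cut IHA IHC.
- exact/d_nnR/d_oneR.
- by move=> G C _ IH; apply/d_nnL_Ko/d_oneL.
- by move=> G; apply/d_nnR/d_topR.
- by move=> G C; apply/d_nnL_Ko/d_zeroL.
- exact/d_nnL_None/d_botL.
- by move=> G _ IH; apply/d_nnR/d_botR.
- by move=> G D A B _ IHA _ IHB; rewrite map_cat; apply/d_nnR/d_tensorR.
- by move=> G A B C _ IH; apply/d_nnL_Ko/d_tensorL.
- by move=> G A B _ IH; apply/d_nnR/d_limpR.
- move=> G D A B C _ IHA _ IHB; rewrite map_cat.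
  exact/d_nnL_Ko/d_limpL.
- by move=> G A B _ IHA _ IHB; apply/d_nnR/d_withR.
- by move=> G A B C _ IH; apply/d_nnL_Ko/d_withL1.
- by move=> G A B C _ IH; apply/d_nnL_Ko/d_withL2.
- by move=> G A B _ IH; apply/d_nnR/d_plusR1.
- by move=> G A B _ IH; apply/d_nnR/d_plusR2.
- by move=> G A B C _ IHA _ IHB; apply/d_nnL_Ko/d_plusL.
- by move=> G A _; rewrite map_Ko_shift => IH; apply/d_nnR/d_allR.
- move=> G A t C _; rewrite Ko_fsubst => IH.
  exact/d_nnL_Ko/d_allL/IH.
- by move=> G A t _; rewrite Ko_fsubst => IH; apply/d_nnR/d_exR/IH.
- move=> G A C _; rewrite map_Ko_shift => IH; apply/d_nnL_Ko/d_exL.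
  by case: C IH => //= C; rewrite Ko_fsubst.
- move=> G A C _ IH; apply/d_nnL_Ko/d_contr.
  (* Contraction leaves two bare copies of [Un Bang (Ko A)]; each is cut against its double
     negation, as the induction hypothesis requires. *)
  apply: (d_cutL (entails_nnI _ _)); apply: d_swap.
  by apply: (d_cutL (entails_nnI _ _)); apply: d_swap.
- by move=> G A C _ IH; apply/d_nnL_Ko/d_weak.
- move=> G A _; rewrite -!map_comp => IH.
  (* Promotion needs a context of bare [!] formulas. The double negations of the conclusion's
     context are removed here, the goal being a negation; those of the induction hypothesis are
     removed below by [entails_nnI]. *)
  apply: (d_replace_all (f := fun B => Un Bang (Ko B))).
    by move=> B D; apply: d_nnL_neg.
  apply: d_nnR.
  have := d_prom (G := [seq Ko B | B <- G]); rewrite -map_comp; apply.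
  by apply: d_replace_all IH => B D; apply: (d_cutL (entails_nnI _ _)).
- by move=> G A C _ IH; apply/d_nnL_Ko/d_derel.
Qed.

Lemma sound_Ko (S : signature) : sound (@CLLb S) (@ILLbot S) (@Ko S).
Proof.
move=> A; split; first exact: Ko_derives.
by apply/interderivable_equivalent/and_comm/CLLb_Ko.
Qed.

Lemma sound_lG (S : signature) : sound (@CLLb S) (@ILLbot S) (@lG S).
Proof.
move=> A; split=> [/(Ko_derives (G := [::])) H|].
  by apply: d_cutR H _; have [] := Ko_lG (fun _ _ => False) A.
apply/interderivable_equivalent/(interderivable_trans _ (Ko_lG _ A)).
exact/and_comm/CLLb_Ko.
Qed.

(** * Modular presentation and simplification *)

Lemma eq_sound (S : signature) (L1 L2 : system S) tr tr' :
  tr =1 tr' -> sound L1 L2 tr -> sound L1 L2 tr'.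
Proof. by move=> E H A; rewrite -E; exact: H. Qed.

Definition Ko_transforms : outer_transforms :=
  OuterTransforms xpredT xpredT.

Definition lG_transforms : outer_transforms :=
  OuterTransforms
    (fun b => match b with Tensor | Plus => true | With | Limp => false end)
    (fun q => match q with Ex | Bang => true | All => false end).

Lemma modular_Ko (S : signature) : @Ko S =1 modular (@nn S) Ko_transforms.
Proof. by elim=> [a|b A IHA B IHB|q A IHA] //=; rewrite ?IHA ?IHB. Qed.

Lemma modular_lG (S : signature) : @lG S =1 modular (@nn S) lG_transforms.
Proof. by elim=> [a|[] A IHA B IHB|[] A IHA] //=; rewrite ?IHA ?IHB. Qed.

Lemma simplification_lG_Ko (S : signature) :
  simplification (@CLLb S) (@ILLbot S) (@nn S) lG_transforms Ko_transforms.
Proof.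
split; [split | by case; auto | by case; auto | by left; exists With].
- exact: eq_sound (@modular_Ko S) (@sound_Ko S).
- exact: eq_sound (@modular_lG S) (@sound_lG S).
- move=> A; rewrite -modular_Ko -modular_lG.
  exact/interderivable_equivalent/Ko_lG.
Qed.

(** * Reduction from outside, and reversibility *)

Lemma outside_in_Ko_lG (S : signature) (A : form S) :
  outside_in (@nn S) (@lG_red S) (Ko A) (lG A).
Proof.
elim: A => [a|b A IHA B IHB|q A IHA] /=.
- by apply: oi_atom; right; split=> // -[F' H]; inversion H.
- have [A' EA] := Ko_nn A; have [B' EB] := Ko_nn B.
  rewrite EA in IHA *; rewrite EB in IHB *.
  (* [Ko_nn] has exposed the inner double negations that the reductions match on. The flag [u]
     records whether the outer one survives the stage: it does exactly for [Tensor] and [Plus],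
     where no reduction matches. *)
  have H u : stage (@lG_red S) (nn (Bin b (nn A') (nn B')))
      (outer (@nn S) u (Bin b (nn A') (nn B'))) ->
    outside_in (@nn S) (@lG_red S) (nn (Bin b (nn A') (nn B')))
      (outer (@nn S) u (Bin b (lG A) (lG B))).
    by move=> st; apply: oi_bin st IHA IHB.
  case: b H => H; [apply: (H true) | apply: (H false) | apply: (H true)
    | apply: (H false)]; try by left; constructor.
  + by right; split=> // -[F' R]; inversion R.
  + by right; split=> // -[F' R]; inversion R.
- have [A' EA] := Ko_nn A; rewrite EA in IHA *.
  have H u : stage (@lG_red S) (nn (Un q (nn A')))
      (outer (@nn S) u (Un q (nn A'))) ->
    outside_in (@nn S) (@lG_red S) (nn (Un q (nn A')))
      (outer (@nn S) u (Un q (lG A))).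
    by move=> st; apply: oi_un st IHA.
  case: q H => H; [apply: (H false) | apply: (H true) | apply: (H true)];
    try by left; constructor.
  + by right; split=> // -[F' R]; inversion R.
  + by right; split=> // -[F' R]; inversion R.
Qed.

(** Starting from [Ko_transforms], any target [t] is reachable: [transform_red] matches at every
    non-atomic stage, as a trivial step where [t] keeps the double negation. *)
Lemma outside_in_transforms (S : signature) (t : outer_transforms) (A : form S) :
  outside_in (@nn S) (transform_red (@nn S) Ko_transforms t)
    (modular (@nn S) Ko_transforms A) (modular (@nn S) t A).
Proof.
rewrite -modular_Ko; elim: A => [a|b A IHA B IHB|q A IHA] /=.
- by apply: oi_atom; right; split=> // -[F' H]; inversion H.
- have [A' EA] := Ko_nn A; have [B' EB] := Ko_nn B.
  rewrite EA in IHA *; rewrite EB in IHB *.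
  apply: oi_bin IHA IHB; left.
  (* Naming [Ko_transforms] makes [outer] compute to [nn], so the left-hand side matches by
     conversion. *)
  exact: (tred_bin _ Ko_transforms).
- have [A' EA] := Ko_nn A; rewrite EA in IHA *.
  apply: oi_un IHA; left.
  exact: (tred_un _ Ko_transforms).
Qed.

Lemma interderivable_lG_red (S : signature) (Ax : system S) F G :
  lG_red F G -> interderivable (derives Ax) F G.
Proof.
case=> [A B|A B|A]; apply: interderivable_stable.
- by apply: stable_with; apply: stable_neg.
- exact/stable_limp/stable_neg.
- exact/stable_all/stable_neg.
Qed.

Theorem proposition12 (S : signature) :
  (forall A : form S, outside_in (@nn S) (@lG_red S) (Ko A) (lG A)) /\
  simplification_from_outside (@CLLb S) (@ILLbot S) (@nn S) (@lG S) (@Ko S) /\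
  (forall F G : form S, lG_red F G -> equivalent (@ILLbot S) F G).
Proof.
split; first exact: outside_in_Ko_lG.
split; last by move=> F G R; apply/interderivable_equivalent/interderivable_lG_red.
exists lG_transforms, Ko_transforms; split.
- exact: modular_lG.
- exact: modular_Ko.
- exact: simplification_lG_Ko.
- by move=> A; rewrite modular_Ko modular_lG; apply: outside_in_transforms.
Qed.
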